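(* Let $(V,\Omega)$ be a finite-dimensional real symplectic vector space, $A\in\mathrm{Sp}(V,\Omega)$, and let $\lambda\notin S^1$ be an eigenvalue of $A$ on $V\otimes_{\mathbb{R}}\mathbb{C}$. Denote $k:=\dim_{\mathbb{C}}\mathrm{Ker}(A-\lambda\mathrm{Id})$ (on $V\otimes_{\mathbb{R}}\mathbb{C}$) and let $p$ be the smallest integer such that $(A-\lambda\mathrm{Id})^{p+1}$ is identically zero on the generalized eigenspace $E_\lambda$. If $\lambda\neq\pm1$ is a real eigenvalue of $A$, there exists a symplectic basis of $V_{[\lambda]}$ in which the matrix associated to the restriction of $A$ to $V_{[\lambda]}$ is a symplectic direct sum of $k$ matrices of the form $$\begin{pmatrix}J(\lambda,p_j+1)&0\\ 0&\bigl(J(\lambda,p_j+1)^{-1}\bigr)^\tau\end{pmatrix}$$ with $p=p_1\ge p_2\ge\dots\ge p_k$. If $\lambda=re^{i\phi}\notin S^1\cup\mathbb{R}$ is a complex eigenvalue of $A$, there exists a symplectic basis of $V_{[\lambda]}$ in which the matrix associated to the restriction of $A$ to $V_{[\lambda]}$ is a symplectic direct sum of $k$ matrices of the form $$\begin{pmatrix}J_{\mathbb{R}}\bigl(re^{i\phi},2(p_j+1)\bigr)&0\\ 0&\Bigl(J_{\mathbb{R}}\bigl(re^{i\phi},2(p_j+1)\bigr)^{-1}\Bigr)^\tau\end{pmatrix}$$ with $p=p_1\ge p_2\ge\dots\ge p_k$.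
   Context: $\mathrm{Sp}(V,\Omega)$ is the group of linear maps preserving $\Omega$; $M^\tau$ is the transpose. For an eigenvalue $\mu$, $E_\mu\subset V\otimes_{\mathbb{R}}\mathbb{C}$ denotes the generalized eigenspace ($\{0\}$ if $\mu$ is not an eigenvalue). $[\lambda]=\{\lambda,1/\lambda,\overline\lambda,1/\overline\lambda\}$, and $V_{[\lambda]}$ is the $A$-stable real symplectic subspace of $V$ whose complexification is $\bigoplus_{\mu\in[\lambda]}E_\mu$. A symplectic basis of a symplectic space of dimension $2m$ is a basis in which the symplectic form has matrix $\begin{pmatrix}0&\mathrm{Id}_m\\ -\mathrm{Id}_m&0\end{pmatrix}$. The symplectic direct sum of $\begin{pmatrix}A_1'&A_2'\\ A_3'&A_4'\end{pmatrix}$ and $\begin{pmatrix}A_1''&A_2''\\ A_3''&A_4''\end{pmatrix}$ (square blocks) is $$\begin{pmatrix}A_1'&0&A_2'&0\\ 0&A_1''&0&A_2''\\ A_3'&0&A_4'&0\\ 0&A_3''&0&A_4''\end{pmatrix}.$$ $J(\lambda,m)$ is the $m\times m$ Jordan matrix with $\lambda$ on the diagonal, $1$ on the superdiagonal, and $0$ elsewhere. $J_{\mathbb{R}}(re^{i\phi},2m)$ is the $2m\times2m$ matrix made of $2\times2$ blocks, with $R(re^{i\phi})=\begin{pmatrix}r\cos\phi&-r\sin\phi\\ r\sin\phi&r\cos\phi\end{pmatrix}$ on the block diagonal, $\mathrm{Id}_2$ on the block superdiagonal, and $0$ elsewhere. *)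

(* Defs.v *)
From HB Require Import structures.
From mathcomp Require Import all_boot all_order all_algebra.
From mathcomp Require Import complex.
From mathcomp Require Import reals trigo.

Set Implicit Arguments.
Unset Strict Implicit.
Unset Printing Implicit Defensive.

Import Order.TTheory GRing.Theory Num.Theory.
Local Open Scope ring_scope.

(** V ⊗_R C as V × V, the pair (u, v) standing for u ⊗ 1 + v ⊗ i. *)
Definition cplx (R : rcfType) (V : vectType R) : Type := (V * V)%type.

Section Complexification.
Context {R : rcfType} {V : vectType R}.
Implicit Types (c d : R[i]) (x y : cplx V).

HB.instance Definition _ := GRing.Zmodule.copy (cplx V) (V * V)%type.

Definition cplx_scale c x : cplx V :=
  (complex.Re c *: x.1 - complex.Im c *: x.2,
   complex.Re c *: x.2 + complex.Im c *: x.1).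

Fact cplx_scalerA c d x : cplx_scale c (cplx_scale d x) = cplx_scale (c * d) x.
Proof.
case: c d x => [a b] [c d] [u v]; congr (_, _) => /=;
  rewrite !(scalerDr, scalerN, scalerDl, scaleNr, scalerBl, scalerA).
- by rewrite !opprD [X in _ + X = _]addrC addrACA.
- by rewrite [RHS]addrACA [X in _ = _ + X]addrC.
Qed.

Fact cplx_scale1r : left_id 1 cplx_scale.
Proof. by case=> u v; rewrite /cplx_scale /= !scale1r !scale0r subr0 addr0. Qed.

Fact cplx_scalerDr : right_distributive cplx_scale +%R.
Proof.
case=> [a b] [u v] [u' v']; congr (_, _) => /=; rewrite !scalerDr.
- by rewrite opprD addrACA.
- by rewrite addrACA.
Qed.

Fact cplx_scalerDl x : {morph cplx_scale^~ x : c d / c + d}.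
Proof.
move: x => [u v] [a b] [c d]; congr (_, _) => /=; rewrite !scalerDl.
- by rewrite opprD addrACA.
- by rewrite addrACA.
Qed.

HB.instance Definition _ := GRing.Zmodule_isLmodule.Build R[i] (cplx V)
  cplx_scalerA cplx_scale1r cplx_scalerDr cplx_scalerDl.


Import VectorInternalTheory.

Definition cplx_in (v : V) : cplx V := (v, 0).

Fact cplx_vect_iso : Vector.axiom (dim V) (cplx V).
Proof.
exists (fun x => \row_j (v2r x.1 0 j +i* v2r x.2 0 j)%C).
- move=> [a b] [u v] [u' v']; apply/rowP=> j; rewrite !mxE.
  have v2rE (c d : R) (w w' w'' : V) : v2r (c *: w + d *: w' + w'') 0 j =
      c * v2r w 0 j + d * v2r w' 0 j + v2r w'' 0 j.
    by rewrite !linearD !linearZ !mxE.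
  transitivity (v2r (a *: u - b *: v + u') 0 j +i*
                v2r (a *: v + b *: u + v') 0 j)%C; first by [].
  by rewrite -scaleNr !v2rE mulNr.
- exists (fun w : 'rV_(dim V) => (r2v (\row_j complex.Re (w 0 j)),
                    r2v (\row_j complex.Im (w 0 j))) : cplx V).
  + by move=> [u v]; congr (_, _); rewrite -[RHS]v2rK;
      congr r2v; apply/rowP=> j; rewrite !mxE.
  + move=> w; apply/rowP=> j; rewrite !mxE !r2vK !mxE /=.
    by case: (w 0 j).
Qed.

HB.instance Definition _ :=
  Lmodule_hasFinDim.Build R[i] (cplx V) cplx_vect_iso.


Definition cplx_fun (A : 'End(V)) x : cplx V := (A x.1, A x.2).

Fact cplx_fun_is_linear (A : 'End(V)) : linear (cplx_fun A).
Proof.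
move=> [a b] [u v] [u' v']; congr (_, _).
- transitivity (A (a *: u - b *: v + u')); first by [].
  by rewrite linearD linearB !linearZ /= scalerN.
- transitivity (A (a *: v + b *: u + v')); first by [].
  by rewrite !linearD !linearZ.
Qed.

HB.instance Definition _ (A : 'End(V)) :=
  GRing.isLinear.Build R[i] (cplx V) (cplx V) _ (cplx_fun A)
    (cplx_fun_is_linear A).

Definition cplx_lfun (A : 'End(V)) : 'End(cplx V) := linfun (cplx_fun A).

Lemma cplx_lfunE (A : 'End(V)) x : cplx_lfun A x = (A x.1, A x.2).
Proof. by rewrite lfunE. Qed.

Definition cplx_vspace (W : {vspace V}) : {vspace cplx V} :=
  <<[seq cplx_in w | w <- vbasis W]>>%VS.

Lemma cplxE x : x = cplx_in x.1 + 'i%C *: cplx_in x.2.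
Proof.
case: x => u v; congr (_, _) => /=.
- by rewrite scale0r scaler0 subr0 addr0.
- by rewrite scale1r scaler0 !add0r.
Qed.

Lemma cplx_inZD (a : R) u v : cplx_in (a *: u + v) = a%:C%C *: cplx_in u + cplx_in v.
Proof. by congr (_, _) => /=; rewrite ?scale0r ?scaler0 ?subr0 ?addr0. Qed.

Lemma cplx_in_vspace (W : {vspace V}) v : v \in W -> cplx_in v \in cplx_vspace W.
Proof.
move=> /coord_vbasis->; elim/big_ind: _ => [|u w uW wW|i _].
- by have := mem0v (cplx_vspace W); congr (_ \in _).
- by rewrite -[u]scale1r cplx_inZD memvD ?memvZ.
- rewrite -[_ *: _]addr0 cplx_inZD memvD ?memvZ //; last first.
    by have := mem0v (cplx_vspace W); congr (_ \in _).
  by rewrite memv_span // map_f // mem_nth ?size_tuple.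
Qed.

Lemma memv_cplx (W : {vspace V}) x : (x \in cplx_vspace W) = (x.1 \in W) && (x.2 \in W).
Proof.
apply/idP/andP => [|[x1W x2W]]; last first.
  by rewrite [x]cplxE memvD ?memvZ ?cplx_in_vspace.
rewrite /cplx_vspace -[map _ _]in_tupleE => /coord_span->.
elim/big_ind: _ => [|u w [u1 u2] [w1 w2]|i _].
- by split; apply: mem0v.
- by split; apply: memvD.
set c := coord _ _ _.
have := mem_nth 0 (ltn_ord i).
move=> /mapP[w /vbasis_mem wW ->].
have -> : c *: cplx_in w = (complex.Re c *: w, complex.Im c *: w) :> cplx V.
  by congr (_, _); rewrite /= scaler0 ?subr0 ?add0r.
by rewrite !memvZ.
Qed.

End Complexification.

Section GeneralizedEigenspaces.
Context {K : fieldType} {U : vectType K}.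

Definition lfun_pow (f : 'End(U)) (n : nat) : 'End(U) :=
  iter n (comp_lfun f) \1%VF.

(** The kernels of the powers of f - mu stabilize at the exponent \dim U
    (see gen_eigenspaceP). *)
Definition gen_eigenspace (f : 'End(U)) (mu : K) : {vspace U} :=
  lker (lfun_pow (f - mu *: \1%VF) (\dim {:U})).

Lemma lfun_powS (f : 'End(U)) n x : lfun_pow f n.+1 x = f (lfun_pow f n x).
Proof. by rewrite comp_lfunE. Qed.

Lemma lfun_powSr (f : 'End(U)) n x : lfun_pow f n.+1 x = lfun_pow f n (f x).
Proof. by elim: n => [|n IHn]; rewrite lfun_powS ?id_lfunE // IHn lfun_powS. Qed.

Lemma lker_powS (f : 'End(U)) n : (lker (lfun_pow f n) <= lker (lfun_pow f n.+1))%VS.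
Proof.
by apply/subvP=> x; rewrite !memv_ker lfun_powS => /eqP->; rewrite linear0.
Qed.

Lemma lker_pow_stable (f : 'End(U)) n m :
  lker (lfun_pow f n.+1) = lker (lfun_pow f n) ->
  lker (lfun_pow f (n + m)) = lker (lfun_pow f n).
Proof.
move=> eq_n; elim: m => [|m IHm]; first by rewrite addn0.
apply/vspaceP=> x; rewrite addnS !memv_ker lfun_powSr -memv_ker IHm.
by rewrite memv_ker -lfun_powSr -memv_ker eq_n memv_ker.
Qed.

Lemma lker_pow_dim (f : 'End(U)) n :
  (lker (lfun_pow f n) <= lker (lfun_pow f (\dim {:U})))%VS.
Proof.
set d := \dim _.
have [m le_md eq_m] : exists2 m, (m <= d)%N &
    lker (lfun_pow f m.+1) = lker (lfun_pow f m).
  suff /existsP[m /eqP/esym eq_m] :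
      [exists m : 'I_d.+1, lker (lfun_pow f m) == lker (lfun_pow f m.+1)].
    by exists m; rewrite // -ltnS.
  apply: contraT => /existsPn neq.
  suff /(_ d.+1 (leqnn _)) : forall m, (m <= d.+1)%N ->
      (m <= \dim (lker (lfun_pow f m)))%N.
    by rewrite leqNgt ltnS dimvS ?subvf.
  elim=> // m IHm lt_md; apply: leq_ltn_trans (IHm (ltnW lt_md)) _.
  rewrite ltn_neqAle dimvS ?lker_powS // andbT.
  by have := neq (Ordinal lt_md); rewrite eqEdim lker_powS /= -ltnNge ltn_neqAle => /andP[].
have powE j : (m <= j)%N -> lker (lfun_pow f j) = lker (lfun_pow f m).
  by move=> /subnKC<-; apply: lker_pow_stable.
rewrite (powE _ le_md); have [/powE->//|/ltnW] := leqP m n.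
by move=> /subnKC<-; elim: (m - n)%N => [|j IHj]; rewrite ?addn0 ?addnS //;
  apply: subv_trans IHj (lker_powS _ _).
Qed.

Lemma gen_eigenspaceP (f : 'End(U)) mu x :
  reflect (exists n, lfun_pow (f - mu *: \1%VF) n x = 0)
          (x \in gen_eigenspace f mu).
Proof.
apply: (iffP idP) => [|[n xn0]]; first by rewrite memv_ker => /eqP; exists (\dim {:U}).
by apply: subvP (lker_pow_dim _ n) _ _; rewrite memv_ker xn0.
Qed.

End GeneralizedEigenspaces.

Section BracketSpace.
Context {R : rcfType} {V : vectType R}.
Implicit Types (A : 'End(V)) (lam : R[i]) (W : {vspace V}).

Definition bracket lam : seq R[i] := undup [:: lam; lam^-1; lam^*; (lam^*)^-1].

(** W = V_[lam].  The sum over the distinct elements of [lam] is automatically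
    direct. *)
Definition is_bracket_space A lam W : Prop :=
  cplx_vspace W = (\sum_(mu <- bracket lam) gen_eigenspace (cplx_lfun A) mu)%VS.

Definition cplx_conj (x : cplx V) : cplx V := (x.1, - x.2).

Fact cplx_conjD : {morph cplx_conj : x y / x + y}.
Proof. by move=> [u v] [u' v']; congr (_, _); rewrite /= opprD. Qed.

Fact cplx_conjZ (c : R[i]) x : cplx_conj (c *: x) = c^* *: cplx_conj x.
Proof.
case: c x => a b [u v]; congr (_, _) => /=.
- by rewrite scaleNr scalerN opprK.
- by rewrite scaleNr scalerN opprD.
Qed.

Fact cplx_conj_gen_eigenspace A mu x :
  x \in gen_eigenspace (cplx_lfun A) mu ->
  cplx_conj x \in gen_eigenspace (cplx_lfun A) mu^*.
Proof.
move=> /gen_eigenspaceP[n xn0]; apply/gen_eigenspaceP; exists n.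
suff -> : lfun_pow (cplx_lfun A - mu^* *: \1%VF) n (cplx_conj x) =
          cplx_conj (lfun_pow (cplx_lfun A - mu *: \1%VF) n x).
  by rewrite xn0; congr (_, _); rewrite /= oppr0.
elim: n {xn0} => [|n IHn]; first by rewrite !id_lfunE.
rewrite !lfun_powS {}IHn; set y := lfun_pow _ _ _.
rewrite !add_lfunE !opp_lfunE !scale_lfunE !id_lfunE !cplx_lfunE cplx_conjD.
congr (_ + _); first by congr (_, _); rewrite /= linearN.
by rewrite -!scaleNr cplx_conjZ rmorphN.
Qed.

Fact cplx_descent (U : {vspace cplx V}) :
  {in U, forall x, cplx_conj x \in U} -> {W | cplx_vspace W = U}.
Proof.
move=> conjU; pose gen := [seq x.1 | x <- vbasis U] ++ [seq x.2 | x <- vbasis U].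
have in1 x : x \in U -> cplx_in x.1 \in U.
  move=> xU; have -> : cplx_in x.1 = (2^-1 : R)%:C%C *: (x + cplx_conj x).
    case: x {xU} => u v; congr (_, _); rewrite /= scale0r.
      by rewrite subr0 -mulr2n -scaler_nat scalerA mulVf ?pnatr_eq0 ?scale1r.
    by rewrite subrr scaler0 addr0.
  by rewrite memvZ ?memvD ?conjU.
have in2 x : x \in U -> cplx_in x.2 \in U.
  move=> xU; have := in1 _ (memvZ (- 'i%C) xU).
  by rewrite /= oppr0 scale0r scaleN1r opprK add0r.
exists <<gen>>%VS; apply/vspaceP=> x; rewrite memv_cplx; apply/andP/idP.
- suff genU w : w \in <<gen>>%VS -> cplx_in w \in U.
    by case=> x1 x2; rewrite [x]cplxE memvD ?memvZ ?genU.
  rewrite -[gen]in_tupleE => /coord_span->.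
  elim/big_ind: _ => [|u v uU vU|i _].
  + by have := mem0v U; congr (_ \in _).
  + by rewrite -[u]scale1r cplx_inZD memvD ?memvZ.
  rewrite -[_ *: _]addr0 cplx_inZD memvD ?memvZ //; last first.
    by have := mem0v U; congr (_ \in _).
  have := mem_nth 0 (ltn_ord i); rewrite mem_cat => /orP[]/mapP[y yU ->].
    exact/in1/vbasis_mem.
  exact/in2/vbasis_mem.
- move=> /coord_vbasis->; elim/big_ind: _ => [|u w [u1 u2] [w1 w2]|i _].
  + by split; apply: mem0v.
  + by split; apply: memvD.
  have /andP[g1 g2] : (((vbasis U)`_i).1 \in <<gen>>%VS) && (((vbasis U)`_i).2 \in <<gen>>%VS).
    by rewrite !memv_span // mem_cat map_f ?orbT // mem_nth ?size_tuple.
  by split; rewrite /= ?memvB ?memvD ?memvZ.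
Qed.

Lemma is_bracket_space_ex A lam : exists! W, is_bracket_space A lam W.
Proof.
rewrite /is_bracket_space; set U := (\sum_(mu <- _) _)%VS.
suff /cplx_descent[W defU] : {in U, forall x, cplx_conj x \in U}.
  exists W; split=> // W'; rewrite -defU => eqW; apply/vspaceP=> v.
  have := congr1 (fun Z : {vspace cplx V} => cplx_in v \in Z) eqW.
  by rewrite !memv_cplx /= !mem0v !andbT.
have subU mu : mu \in bracket lam -> (gen_eigenspace (cplx_lfun A) mu <= U)%VS.
  by move=> mu_in; rewrite /U (big_rem mu) //= addvSl.
rewrite /U; have : {subset bracket lam <= bracket lam} by [].
elim: {1 3}(bracket lam) => [|mu s IHs] sub_s x.
  rewrite big_nil memv0 => /eqP->.
  suff -> : cplx_conj (0 : cplx V) = 0 by apply: mem0v.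
  by congr (_, _); rewrite /= oppr0.
rewrite big_cons => /memv_addP[y yE [z zS ->]].
rewrite cplx_conjD memvD //; last first.
  by apply: IHs zS => nu nu_s; rewrite sub_s // inE nu_s orbT.
apply: subvP (subU _ _) _ (cplx_conj_gen_eigenspace yE).
have := sub_s mu (mem_head _ _); rewrite /bracket !mem_undup !inE.
by case/or4P=> /eqP->; rewrite ?fmorphV /= ?conjCK eqxx ?orbT.
Qed.

End BracketSpace.

Section SymplecticMatrices.
Context {R : realType}.

Definition symplectic_mx m : 'M[R]_(m + m) := block_mx 0 1%:M (- 1%:M) 0.

Definition Jordan (lam : R) m : 'M[R]_m :=
  \matrix_(i, j) (lam *+ (i == j) + (i.+1 == j)%:R).

Definition rot (r phi : R) : 'M[R]_2 :=
  \matrix_(i, j) (nth [::] [:: [:: r * cos phi; - (r * sin phi)];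
                               [:: r * sin phi; r * cos phi]] i)`_j.

(** J_R(r e^(i phi), 2 m); its size 2 m is written as the sum of m block
    sizes 2. *)
Definition Jordan_real (r phi : R) m : 'M[R]_(\sum_(i < m) 2) :=
  \mxblock_(i < m, j < m)
    (rot r phi *+ (i == j) + 1%:M *+ (i.+1 == j)).

Definition inv_tr_block m (M : 'M[R]_m) : 'M[R]_(m + m) :=
  block_mx M 0 0 (invmx M)^T.

Definition sympl_sum m1 m2 (M1 : 'M[R]_(m1 + m1)) (M2 : 'M[R]_(m2 + m2)) :
    'M[R]_((m1 + m2) + (m1 + m2)) :=
  block_mx (block_mx (ulsubmx M1) 0 0 (ulsubmx M2))
           (block_mx (ursubmx M1) 0 0 (ursubmx M2))
           (block_mx (dlsubmx M1) 0 0 (dlsubmx M2))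
           (block_mx (drsubmx M1) 0 0 (drsubmx M2)).

(** Iterated symplectic direct sum of the blocks B q, q ranging over s, with
    the 0 × 0 matrix as neutral element. *)
Fixpoint sympl_sums (d : nat -> nat) (B : forall q, 'M[R]_(d q + d q))
    (s : seq nat) : 'M[R]_(sumn (map d s) + sumn (map d s)) :=
  if s is q :: s' then sympl_sum (B q) (sympl_sums B s') else 0.

End SymplecticMatrices.

Definition is_symplectic_basis (R : realType) (V : vectType R)
    (Omega : V -> V -> R) (W : {vspace V}) m (e : (m + m).-tuple V) : Prop :=
  basis_of W e /\
  forall i j, Omega (tnth e i) (tnth e j) = symplectic_mx m i j.

(** Column j of M holds the coordinates of A e_j (unlike [mxof], which acts on
    row vectors). *)
Definition has_matrix (R : realType) (V : vectType R) (A : 'End(V)) n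
    (e : n.-tuple V) (M : 'M[R]_n) : Prop :=
  forall j, A (tnth e j) = \sum_i M i j *: tnth e i.

(* Main.v *)
From HB Require Import structures.
Require Import Defs.
From mathcomp Require Import all_boot all_order all_algebra.
From mathcomp Require Import complex.
From mathcomp Require Import reals trigo.
From mathcomp Require Import zify ring.

Set Implicit Arguments.
Unset Strict Implicit.
Unset Printing Implicit Defensive.

Import Order.TTheory GRing.Theory Num.Theory.
Local Open Scope ring_scope.

(** Omega pairs the eigenvalue mu with the eigenvalue 1/mu only: since A preserves it, Omega (A x, (A - 1/mu) y) = - 1/mu Omega ((A - mu) x, y), so the
generalized eigenspace E_mu is orthogonal to the image of (A - 1/mu)^n for large n
([pow_orthogonal]).  As A - 1/mu is bijective on E_nu for nu <> 1/mu, this makes E_mu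
orthogonal to E_nu as soon as mu nu <> 1; as V is the sum of E_(1/mu) and of the image
of (A - 1/mu)^n, it also makes the pairing of E_mu with E_(1/mu) nondegenerate.

Let L and L' be the real subspaces whose complexifications are E_lam + E_(lam^* ) and
E_(1/lam) + E_(1/lam^* ).  None of lam^2, |lam|^2 and their inverses is 1 because lam is
off the unit circle, so L and L' are isotropic, Omega puts them in duality, and
V_[lam] = L + L'.  Choose any basis e of L, and let M be the matrix of A on L.  The basis
f of L' dual to e completes it to a symplectic basis, and Omega (A e_i, A f_j) =
Omega (e_i, f_j) forces the matrix of A on f to be the inverse transpose of M
([symplectic_extension]).  A block diagonal M then gives the symplectic direct sum
of the matrices built on its blocks ([sympl_sums_inv_tr_block]).

It remains to put A in Jordan form on L.  For real lam, L is the generalized eigenspace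
of A over the reals and the Jordan form of the nilpotent A - lam does it.  Otherwise
take a Jordan basis z_1, ..., z_d of E_lam over the complex numbers: the vectors Re z_j,
- Im z_j form a basis of L, in which each complex Jordan block becomes a real one with
rotation blocks ([has_matrix_Jordan_real]).

The Jordan form of a nilpotent g on E is built by induction on the nilpotency index
([nilpotent_chain_basis]): lift the chains of g(E) one step up, and add a complement of
their last vectors in the kernel of g as chains of length one.  The lengths come out
sorted, the last vectors of the chains form a basis of the kernel, so that the number of
chains is the dimension of the kernel, and the longest chain has length p + 1. *)

(** * Chain bases of nilpotent maps *)

Section NilpotentChains.
Context {K : fieldType} {U : vectType K}.
Implicit Types (g : 'End(U)) (E : {vspace U}) (c : U * nat) (s : seq (U * nat)).

(** The order, from g^q x up to x, is the one in which g has a superdiagonal Jordan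
    matrix. *)
Definition chain g c : seq U :=
  mkseq (fun i => lfun_pow g (c.2 - i) c.1) c.2.+1.

Definition chains g s : seq U := flatten (map (chain g) s).

Definition bottoms g s : seq U := [seq lfun_pow g c.2 c.1 | c <- s].

Lemma lfun_powD g m n x : lfun_pow g (m + n) x = lfun_pow g m (lfun_pow g n x).
Proof. by elim: m => [|m IHm]; rewrite ?id_lfunE // addSn !lfun_powS IHm. Qed.

Lemma chain_lift g x q : chain g (x, q.+1) = rcons (chain g (g x, q)) x.
Proof.
have -> : chain g (x, q.+1) = rcons (mkseq (fun i => lfun_pow g (q.+1 - i) x) q.+1) x.
  by rewrite /chain mkseqS subnn id_lfunE.
congr rcons; apply/eq_in_map => i; rewrite mem_iota /= add0n ltnS => le_iq.
by rewrite subSn // lfun_powSr.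
Qed.

(** Together with [chain_lift]: replacing the top y of a chain by a preimage of y adds
    one vector to the chain, and g maps all but the first vector of the new chain onto the
    old one. *)
Lemma chain_drop g x q :
  chain g (x, q.+1) = lfun_pow g q.+1 x :: chain g (x, q).
Proof.
rewrite /chain /mkseq -[(x, q.+1).2.+1]/(1 + q.+1)%N iotaD map_cat; congr (_ :: _).
by rewrite [iota _ _](iotaDl 1 0) -map_comp.
Qed.

Lemma map_chain g x q : map g (chain g (x, q)) = chain g (g x, q).
Proof.
rewrite /chain /mkseq -map_comp; apply: eq_map => i /=.
by rewrite -lfun_powS lfun_powSr.
Qed.

Lemma mem_chainP g c v :
  reflect (exists2 i, (i <= c.2)%N & v = lfun_pow g (c.2 - i) c.1) (v \in chain g c).
Proof.
by apply: (iffP mapP) => -[i lt_i ->]; exists i => //; rewrite mem_iota in lt_i *.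
Qed.

Lemma mem_chain_top g c : c.1 \in chain g c.
Proof. by case: c => x [|q]; rewrite ?chain_lift ?mem_rcons !inE ?id_lfunE eqxx. Qed.

Lemma mem_chain_bottom g c : lfun_pow g c.2 c.1 \in chain g c.
Proof. by rewrite /chain /mkseq /= subn0 mem_head. Qed.

Lemma mem_chains g s c : c \in s -> {subset chain g c <= chains g s}.
Proof. by move=> cs v vc; apply/flattenP; exists (chain g c); rewrite ?map_f. Qed.

Lemma mem_chainsP g s v :
  reflect (exists2 c, c \in s & v \in chain g c) (v \in chains g s).
Proof.
apply: (iffP flattenP) => [[_ /mapP[c cs ->] vc]|[c cs vc]]; first by exists c.
by exists (chain g c); rewrite ?map_f.
Qed.

Lemma size_chains g s : size (chains g s) = sumn (map (fun c => c.2.+1) s).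
Proof.
rewrite size_flatten /shape -map_comp; congr sumn.
by apply: eq_map => c; apply: size_mkseq.
Qed.

Lemma chains_preimage g E s : {in s, forall c, c.1 \in (g @: E)%VS} ->
  exists2 t, {in t, forall c, c.1 \in E} & s = [seq (g c.1, c.2) | c <- t].
Proof.
elim: s => [|[y q] s IHs] sE; first by exists [::].
have [|t tE ->] := IHs; first by move=> c cs; apply: sE; rewrite inE cs orbT.
have /memv_imgP[x xE /= ->] := sE _ (mem_head _ _).
by exists ((x, q) :: t) => // c; rewrite inE => /predU1P[->|/tE].
Qed.

(** Induction on n, applied to g(E).  Let S be the span of the new chains.  Then
    g(S) = g(E) and S contains the kernel of g in E, hence S = E; the number of
    vectors is dim E by the rank formula.  The basis of the kernel is part of the
    induction, as it is what tells how many chains of length one are missing. *)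
Lemma nilpotent_chain_basis g n E :
    (g @: E <= E)%VS -> (E <= lker (lfun_pow g n))%VS ->
  exists s, [/\ basis_of E (chains g s), basis_of (E :&: lker g) (bottoms g s)
              & sorted geq (map snd s)].
Proof.
elim: n E => [|n IHn] E gE En.
  suff -> : E = 0%VS by exists [::]; rewrite cap0v nil_basis.
  apply/eqP; rewrite -subv0; apply: subv_trans En _.
  by apply/subvP => x; rewrite memv_ker id_lfunE memv0.
have [||s [sB sK s_sorted]] := IHn (g @: E)%VS; first exact: limgS.
  apply/subvP => _ /memv_imgP[x xE ->].
  by have := subvP En _ xE; rewrite !memv_ker lfun_powSr.
have [|t tE def_s] := @chains_preimage g E s.
  by move=> c cs; apply: (basis_mem sB); apply: mem_chains cs _ (mem_chain_top _ _).
set KE := (E :&: lker g)%VS in sK *; set KgE := (_ :&: lker g)%VS in sK.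
have sub_K : (KgE <= KE)%VS by rewrite capvS.
pose Z := vbasis (KE :\: KgE).
pose lifts := [seq (c.1, c.2.+1) | c <- t].
pose s1 := lifts ++ [seq (z, 0%N) | z <- Z].
have s1K : bottoms g s1 = bottoms g s ++ Z.
  rewrite /bottoms map_cat -!map_comp def_s -map_comp; congr (_ ++ _).
    by apply: eq_map => c /=; rewrite -lfun_powSr.
  by rewrite -[RHS]map_id; apply: eq_map => z /=; rewrite id_lfunE.
have basisK : basis_of KE (bottoms g s1).
  have -> : KE = (KgE + (KE :\: KgE))%VS by rewrite addvC addv_diff (addv_idPl sub_K).
  rewrite s1K cat_basis ?vbasisP //.
  by apply/directv_addP; rewrite capvC capv_diff.
exists s1; split=> //.
- rewrite basisEdim; apply/andP; split.
  + apply/subvP => v vE.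
    have /memv_imgP[w w_s gv] : g v \in (g @: <<chains g s1>>)%VS.
      suff /subvP-> : (g @: E <= g @: <<chains g s1>>)%VS by [|apply: memv_img].
      rewrite -[X in (X <= _)%VS](span_basis sB); apply/span_subvP => y.
      move=> /mem_chainsP[c]; rewrite def_s => /mapP[b bt ->] yb.
      rewrite -map_chain in yb; have /mapP[z zb ->] := yb.
      apply: memv_img; apply/memv_span; apply: (@mem_chains _ _ (b.1, b.2.+1)).
        by rewrite mem_cat (map_f (fun b => (b.1, b.2.+1))).
      by rewrite chain_drop inE; case: b zb {bt yb} => ? ? ->; rewrite orbT.
    have vw : v - w \in KE.
      rewrite memv_cap memv_ker linearB /= gv subrr eqxx andbT memvB //.
      apply: subvP w_s; apply/span_subvP => y /mem_chainsP[c].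
      rewrite mem_cat => /orP[]/mapP[b bt ->].
        case/mem_chainP=> i _ -> /=; elim: (_ - i)%N => [|j IHj].
          by rewrite id_lfunE; apply: tE.
        by rewrite lfun_powS; apply: (subvP gE); apply: memv_img.
      rewrite inE id_lfunE => /eqP-> /=.
      by have := vbasis_mem bt; apply: subvP; apply: subv_trans (diffvSl _ _) (capvSl _ _).
    rewrite -(subrK w v) memvD //; rewrite -(span_basis basisK) in vw.
    apply: subvP vw; apply/sub_span => y /mapP[c cs ->].
    exact: (mem_chains cs (mem_chain_bottom _ _)).
  + rewrite -(limg_ker_dim g E) -/KE.
    rewrite (size_basis (X := in_tuple _) basisK) (size_basis (X := in_tuple _) sB).
    rewrite s1K size_cat !size_chains map_cat sumn_cat def_s -!map_comp !size_map.
    rewrite addnAC leq_add //.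
      by elim: (t) => //= c t' IHt; lia.
    by elim: (tval Z) => //= z Zs IHz; lia.
- have geq_trans : transitive geq by move=> a b c ba cb; apply: leq_trans cb ba.
  rewrite sorted_pairwise // in s_sorted; rewrite sorted_pairwise //.
  rewrite def_s -map_comp pairwise_map in s_sorted.
  rewrite map_cat -!map_comp pairwise_cat !pairwise_map; apply/and3P; split.
  + by apply/allrelP => _ _ /mapP[? _ ->] /mapP[? _ ->].
  + exact: s_sorted.
  + by elim: (tval Z) => //= z Zs ->; rewrite andbT; apply/allP.
Qed.

(** The chains being sorted, the first is the longest: the power of g equal to
    its length kills E, and the previous power does not kill its top. *)
Lemma nilpotency_index g E s p :
    basis_of E (chains g s) -> basis_of (E :&: lker g) (bottoms g s) ->
    sorted geq (map snd s) -> E != 0%VS ->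
    (E <= lker (lfun_pow g p.+1))%VS ->
    (forall q, (E <= lker (lfun_pow g q.+1))%VS -> (p <= q)%N) ->
  head 0%N (map snd s) = p.
Proof.
case: s => [|c s] sB sK s_sorted E_neq0 Ep pmin.
  by rewrite -(span_basis sB) span_nil eqxx in E_neq0.
have top_le b : b \in c :: s -> (b.2 <= c.2)%N.
  rewrite inE => /predU1P[->//|bs].
  have geq_trans : transitive geq by move=> i j k ji kj; apply: leq_trans kj ji.
  have /allP := order_path_min geq_trans s_sorted; apply; exact: map_f.
apply/eqP; rewrite /= eqn_leq; apply/andP; split.
- have cE : c.1 \in E.
    by apply: (basis_mem sB); apply: mem_chains (mem_head _ _) _ (mem_chain_top _ _).
  rewrite leqNgt; apply/negP => lt_pc.
  have /negP[] := basis_not0 sK (mem_head _ _); apply/eqP.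
  rewrite -(subnK lt_pc) lfun_powD.
  by have := subvP Ep _ cE; rewrite memv_ker => /eqP->; rewrite linear0.
- apply: pmin; rewrite -[X in (X <= _)%VS](span_basis sB).
  apply/span_subvP => _ /mem_chainsP[b bs /mem_chainP[i _ ->]].
  have bottom0 : lfun_pow g b.2.+1 b.1 = 0.
    have := basis_mem sK (map_f (fun b => lfun_pow g b.2 b.1) bs).
    by rewrite memv_cap memv_ker -lfun_powS => /andP[_ /eqP].
  rewrite memv_ker -lfun_powD.
  have /subnK <- : (b.2.+1 <= c.2.+1 + (b.2 - i))%N.
    by rewrite (leq_trans _ (leq_addr _ _)) // ltnS top_le.
  by rewrite lfun_powD bottom0 linear0.
Qed.

End NilpotentChains.

(** * Generalized eigenspaces *)

Section GeneralizedEigenspaceTheory.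
Context {K : fieldType} {U : vectType K}.
Implicit Types (f : 'End(U)) (mu nu : K) (x y : U).

Lemma sub_scaleE f mu x : (f - mu *: \1%VF) x = f x - mu *: x.
Proof. by rewrite add_lfunE opp_lfunE scale_lfunE id_lfunE. Qed.

Lemma lfun_pow_commute f mu n x :
  f (lfun_pow (f - mu *: \1%VF) n x) = lfun_pow (f - mu *: \1%VF) n (f x).
Proof.
have fE y : f y = (f - mu *: \1%VF) y + mu *: y by rewrite sub_scaleE subrK.
by rewrite [LHS]fE -lfun_powS lfun_powSr -linearZ -linearD -fE.
Qed.

Lemma gen_eigenspace_stable f mu x :
  x \in gen_eigenspace f mu -> f x \in gen_eigenspace f mu.
Proof. by rewrite !memv_ker -lfun_pow_commute => /eqP->; rewrite linear0. Qed.

Lemma gen_eigenspace_sub_stable f mu nu x :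
  x \in gen_eigenspace f mu -> (f - nu *: \1%VF) x \in gen_eigenspace f mu.
Proof. by move=> xE; rewrite sub_scaleE memvB ?memvZ ?gen_eigenspace_stable. Qed.

Lemma gen_eigenspace_sub_inj f mu nu x : mu != nu ->
  x \in gen_eigenspace f mu -> (f - nu *: \1%VF) x = 0 -> x = 0.
Proof.
move=> neq_mu; rewrite memv_ker sub_scaleE => /eqP + /eqP; set n := \dim _.
rewrite subr_eq0 => xn0 /eqP fx; have powE m :
    lfun_pow (f - mu *: \1%VF) m x = (nu - mu) ^+ m *: x.
  elim: m => [|m IHm]; first by rewrite id_lfunE scale1r.
  by rewrite lfun_powS IHm linearZ /= sub_scaleE fx -scalerBl scalerA exprSr.
move/eqP: xn0; rewrite powE scaler_eq0 expf_eq0 subr_eq0 [nu == _]eq_sym.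
by rewrite (negPf neq_mu) andbF => /eqP.
Qed.

Lemma gen_eigenspace_cap f mu nu : mu != nu ->
  (gen_eigenspace f mu :&: gen_eigenspace f nu = 0)%VS.
Proof.
move=> neq_mu; apply/eqP; rewrite -subv0; apply/subvP => x.
rewrite memv_cap => /andP[xE /gen_eigenspaceP[n]]; rewrite memv0.
elim: n x xE => [|n IHn] x xE; first by rewrite id_lfunE => ->.
rewrite lfun_powSr => /(IHn _ (gen_eigenspace_sub_stable _ xE)) /eqP gx0.
by rewrite (gen_eigenspace_sub_inj neq_mu xE gx0).
Qed.

Lemma gen_eigenspace_sub_img f mu nu n : mu != nu ->
  (lfun_pow (f - nu *: \1%VF) n @: gen_eigenspace f mu)%VS = gen_eigenspace f mu.
Proof.
move=> neq_mu; elim: n => [|n IHn]; first by rewrite lim1g.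
rewrite limg_comp IHn; apply/eqP; rewrite eqEdim; apply/andP; split.
  by apply/subvP => _ /memv_imgP[x xE ->]; apply: gen_eigenspace_sub_stable.
rewrite limg_dim_eq //; apply/eqP; rewrite -subv0; apply/subvP => x.
rewrite memv_cap memv_ker memv0 => /andP[xE /eqP gx0].
by rewrite (gen_eigenspace_sub_inj neq_mu xE gx0).
Qed.

Lemma fitting f mu :
  (gen_eigenspace f mu + limg (lfun_pow (f - mu *: \1%VF) (\dim {:U})))%VS = fullv.
Proof.
set g := lfun_pow _ _; apply/eqP; rewrite eqEdim subvf dimv_disjoint_sum.
  have := limg_ker_dim g fullv; rewrite capfv => dim_g.
  by rewrite /= -[X in (X <= _)%N]dim_g leqnn.
apply/eqP; rewrite -subv0; apply/subvP => x; rewrite memv_cap memv0.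
case/andP=> + /memv_imgP[y _ xE]; rewrite memv_ker xE -lfun_powD => /eqP gy.
have : y \in gen_eigenspace f mu by apply/gen_eigenspaceP; eexists; apply: gy.
by rewrite memv_ker.
Qed.

Lemma lker_sub_gen_eigenspace f mu :
  (lker (f - mu *: \1%VF) <= gen_eigenspace f mu)%VS.
Proof.
apply/subvP => x; rewrite memv_ker => /eqP x0; apply/gen_eigenspaceP.
by exists 1%N; rewrite lfun_powS id_lfunE.
Qed.

End GeneralizedEigenspaceTheory.

(** * Orthogonality of the generalized eigenspaces of an isometry *)

Section IsometryEigenspaces.
Context {K : fieldType} {U : vectType K} (B : U -> U -> K) (f : 'End(U)).
Hypothesis B_linearl : forall y, linear (B^~ y : U -> K^o).
Hypothesis B_linearr : forall x, linear (B x : U -> K^o).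
Hypothesis B_nondeg : forall x, (forall y, B x y = 0) -> x = 0.
Hypothesis f_isometry : forall x y, B (f x) (f y) = B x y.
Implicit Types (mu nu : K) (x y : U).

Let BZDl a x y z : B (a *: x + y) z = a * B x z + B y z.
Proof. exact: (B_linearl z a x y). Qed.

Let BZDr a x y z : B x (a *: y + z) = a * B x y + B x z.
Proof. exact: (B_linearr x a y z). Qed.

Let B0l y : B 0 y = 0.
Proof. by have := BZDl (-1) 0 0 y; rewrite scaler0 addr0 mulN1r addNr. Qed.

Lemma isometry_ker0 : lker f == 0%VS.
Proof.
apply/lker0P => x y eq_f; apply/eqP; rewrite -subr_eq0; apply/eqP/B_nondeg => z.
rewrite -f_isometry linearB /= eq_f subrr; exact: B0l.
Qed.

(** With x = f x', the isometry turns one factor f - 1/mu on the second argument into a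
    factor f - mu on the first; n steps kill x. *)
Lemma pow_orthogonal mu n x y : mu != 0 ->
  lfun_pow (f - mu *: \1%VF) n x = 0 -> B x (lfun_pow (f - mu^-1 *: \1%VF) n y) = 0.
Proof.
move=> mu_neq0; elim: n x => [|n IHn] x; first by rewrite id_lfunE => ->; apply: B0l.
have fK := lker0_lfunVK isometry_ker0; have /lker0P f_inj := isometry_ker0.
rewrite -[x]fK -lfun_pow_commute; set x' := (f^-1)%VF x => /eqP.
rewrite -[X in _ == X](linear0 f) => /eqP/f_inj.
rewrite lfun_powSr => /IHn; rewrite lfun_powS; set z := lfun_pow _ n y.
rewrite !sub_scaleE => Bx'z.
have -> : B (f x') (f z - mu^-1 *: z) = - mu^-1 * B (f x' - mu *: x') z.
  rewrite ![_ - _ *: _]addrC -!scaleNr BZDr BZDl f_isometry.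
  by rewrite mulrDr mulrA mulrNN mulVf // mul1r addrC.
by rewrite Bx'z mulr0.
Qed.

(** For nu <> 1/mu, the map f - 1/mu is onto on the generalized eigenspace of nu, so
    that y lies in the image of every power of it. *)
Lemma gen_eigenspace_orthogonal mu nu x y : mu != 0 -> mu * nu != 1 ->
  x \in gen_eigenspace f mu -> y \in gen_eigenspace f nu -> B x y = 0.
Proof.
move=> mu_neq0 neq1; have neq_nu : nu != mu^-1.
  by apply: contraNneq neq1 => ->; rewrite divff.
rewrite memv_ker -{1}(gen_eigenspace_sub_img f (\dim {:U}) neq_nu) => /eqP xE.
by case/memv_imgP => z _ ->; apply: pow_orthogonal.
Qed.

(** By the Fitting decomposition at 1/mu, a vector orthogonal to the generalized
    eigenspace of 1/mu, and already orthogonal to the other summand, is orthogonal to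
    everything. *)
Lemma gen_eigenspace_pairing mu x : mu != 0 -> x \in gen_eigenspace f mu ->
  {in gen_eigenspace f mu^-1, forall y, B x y = 0} -> x = 0.
Proof.
move=> mu_neq0 xE x_orth; apply: B_nondeg => v.
have : v \in fullv by apply: memvf.
rewrite -(fitting f mu^-1) => /memv_addP[y yE [_ /memv_imgP[z _ ->] ->]].
rewrite -[y]scale1r BZDr x_orth // mulr0 add0r; apply: pow_orthogonal => //.
by apply/eqP; rewrite -memv_ker.
Qed.

End IsometryEigenspaces.

(** * Real subspaces of the complexification *)

Section ComplexifiedEigenspaces.
Context {R : rcfType} {V : vectType R} (A : 'End(V)).
Implicit Types (l : R) (lam mu : R[i]) (L X : {vspace V}) (x y z : cplx V).

Lemma cplx_pow_real l n x :
  lfun_pow (cplx_lfun A - l%:C%C *: \1%VF) n x =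
    (lfun_pow (A - l *: \1%VF) n x.1, lfun_pow (A - l *: \1%VF) n x.2).
Proof.
elim: n => [|n IHn]; first by rewrite !id_lfunE; case: x.
rewrite !lfun_powS IHn !sub_scaleE cplx_lfunE; congr (_, _) => /=;
  by rewrite scale0r ?subr0 ?addr0.
Qed.

Lemma gen_eigenspace_real l :
  gen_eigenspace (cplx_lfun A) l%:C%C = cplx_vspace (gen_eigenspace A l).
Proof.
apply/vspaceP => x; rewrite memv_cplx; apply/gen_eigenspaceP/andP.
  case=> n; rewrite cplx_pow_real => -[x1 x2].
  by split; apply/gen_eigenspaceP; exists n.
rewrite !memv_ker => -[/eqP x1 /eqP x2]; exists (\dim {:V}).
by rewrite cplx_pow_real x1 x2.
Qed.

Lemma leigenspace_real l :
  passmx.leigenspace (cplx_lfun A) l%:C%C = cplx_vspace (lker (A - l *: \1%VF)).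
Proof.
apply/vspaceP => x; rewrite memv_cplx !memv_ker.
have powE (K : fieldType) (U : vectType K) (g : 'End(U)) (y : U) : g y = lfun_pow g 1 y.
  by rewrite lfun_powS id_lfunE.
rewrite powE cplx_pow_real -!powE.
by apply/eqP/andP => [[-> ->]|[/eqP-> /eqP->]].
Qed.

Lemma sub_lker_pow_real l n X :
  (cplx_vspace X <= lker (lfun_pow (cplx_lfun A - l%:C%C *: \1%VF) n))%VS =
    (X <= lker (lfun_pow (A - l *: \1%VF) n))%VS.
Proof.
apply/subvP/subvP => sub_ker v.
  move=> /cplx_in_vspace/sub_ker; rewrite !memv_ker cplx_pow_real.
  by move=> /eqP[-> _].
rewrite memv_cplx => /andP[/sub_ker + /sub_ker]; rewrite !memv_ker cplx_pow_real.
by move=> /eqP-> /eqP->.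
Qed.

Lemma dim_cplx_vspace X : \dim (cplx_vspace X) = \dim X.
Proof.
suff free_in : free (map_tuple cplx_in (vbasis X)).
  by rewrite /cplx_vspace (eqP free_in) size_tuple.
have /freeP free_b := basis_free (vbasisP X).
apply/freeP => c sum0 i.
have sumE : \sum_(j < \dim X) c j *: [seq cplx_in w | w <- vbasis X]`_j =
    (\sum_(j < \dim X) complex.Re (c j) *: (vbasis X)`_j,
     \sum_(j < \dim X) complex.Im (c j) *: (vbasis X)`_j) :> cplx V.
  elim/big_rec3: _ => // j a b d _ ->; rewrite (nth_map 0) ?size_tuple //.
  by congr (_, _) => /=; rewrite scaler0 ?subr0 ?add0r.
move: sum0; rewrite sumE => -[/free_b Re0 /free_b Im0].
by apply/eqP; rewrite eq_complex Re0 Im0 !eqxx.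
Qed.

Lemma cplx_conjK : involutive (@cplx_conj R V).
Proof. by case=> u v; congr (_, _); rewrite /= opprK. Qed.

Lemma free_conj n (e : n.-tuple (cplx V)) :
  free e -> free (map_tuple (@cplx_conj R V) e).
Proof.
move=> /freeP free_e; apply/freeP => c sum0 i.
suff /eqP : (c i)^* = 0 by rewrite conjC_eq0 => /eqP.
have conj0 : cplx_conj 0 = 0 :> cplx V by congr (_, _); rewrite /= oppr0.
apply: (free_e (fun i => (c i)^*)); rewrite -[RHS]conj0 -[in RHS]sum0.
elim/big_rec2: _ => [|j x y _ ->]; first by rewrite conj0.
by rewrite cplx_conjD cplx_conjZ (nth_map 0) ?size_tuple // cplx_conjK.
Qed.

Lemma dim_gen_eigenspace_conj lam :
  (\dim (gen_eigenspace (cplx_lfun A) lam) <=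
   \dim (gen_eigenspace (cplx_lfun A) lam^*))%N.
Proof.
have free_b := free_conj (basis_free (vbasisP (gen_eigenspace (cplx_lfun A) lam))).
rewrite -[X in (X <= _)%N](size_tuple (map_tuple (@cplx_conj R V) (vbasis _))).
rewrite -(eqP free_b) dimvS //.
by apply/span_subvP => _ /mapP[z /vbasis_mem zE ->]; apply: cplx_conj_gen_eigenspace.
Qed.

Lemma double_dim_gen_eigenspace lam L : lam != lam^* ->
  cplx_vspace L = (gen_eigenspace (cplx_lfun A) lam +
                   gen_eigenspace (cplx_lfun A) lam^*)%VS ->
  (2 * \dim (gen_eigenspace (cplx_lfun A) lam) <= \dim L)%N.
Proof.
move=> neq_lam defL; rewrite -dim_cplx_vspace defL.
rewrite dimv_disjoint_sum ?gen_eigenspace_cap //.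
by rewrite mul2n -addnn leq_add2l dim_gen_eigenspace_conj.
Qed.

(** If v in L is y + w with y in E_lam and w in E_(lam^* ), then v is the real part of
    y plus the conjugate of w, which is in E_lam: every vector of L is the real part of
    a vector of E_lam. *)
Lemma sub_real_parts lam L X (zs : seq (cplx V)) :
  cplx_vspace L = (gen_eigenspace (cplx_lfun A) lam +
                   gen_eigenspace (cplx_lfun A) lam^*)%VS ->
  basis_of (gen_eigenspace (cplx_lfun A) lam) zs ->
  {in zs, forall z, z.1 \in X /\ z.2 \in X} -> (L <= X)%VS.
Proof.
move=> defL zsE zsX; apply/subvP => v /cplx_in_vspace; rewrite defL.
have subX : (gen_eigenspace (cplx_lfun A) lam <= cplx_vspace X)%VS.
  rewrite -(span_basis zsE); apply/span_subvP => z /zsX[z1 z2].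
  by rewrite memv_cplx z1 z2.
case/memv_addP=> y yE [w wE vE]; have -> : v = y.1 + w.1.
  by have := congr1 fst vE.
rewrite memvD //; first by have := subvP subX _ yE; rewrite memv_cplx => /andP[].
have := cplx_conj_gen_eigenspace wE; rewrite conjCK => /(subvP subX).
by rewrite memv_cplx => /andP[].
Qed.

End ComplexifiedEigenspaces.

(** * Duality of the real subspaces attached to lam and 1/lam *)

Section ComplexifiedForm.
Context {R : rcfType} {V : vectType R} (Omega : {skew_symmetric V}) (A : 'End(V)).
Hypothesis Omega_nondeg : nondegenerate Omega.
Hypothesis A_isometry : isometry Omega Omega A.
Implicit Types (lam mu : R[i]) (L : {vspace V}) (x y : cplx V).

Definition cplx_form x y : R[i] :=
  ((Omega x.1 y.1 - Omega x.2 y.2) +i* (Omega x.1 y.2 + Omega x.2 y.1))%C.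

Lemma cplx_form_linearl y : linear (cplx_form^~ y : cplx V -> R[i]^o).
Proof.
move=> [a b] [u v] [u' v']; rewrite /cplx_form /=.
rewrite !(linearDl, linearNl, linearZl_LR) /=.
apply/eqP; rewrite eq_complex /=; apply/andP; split; apply/eqP; rewrite /GRing.scale /=; ring.
Qed.

Lemma cplx_form_linearr x : linear (cplx_form x : cplx V -> R[i]^o).
Proof.
move=> [a b] [u v] [u' v']; rewrite /cplx_form /=.
rewrite !(linearDr, linearNr, linearZr_LR) /=.
apply/eqP; rewrite eq_complex /=; apply/andP; split; apply/eqP; rewrite /GRing.scale /=; ring.
Qed.

Lemma Omega_nondegP u : (forall v, Omega u v = 0) -> u = 0.
Proof.
move=> u_orth; apply/eqP; rewrite -memv0 -(eqP Omega_nondeg).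
by apply/mem_orthovP => v _; apply: u_orth.
Qed.

Lemma cplx_form_nondeg x : (forall y, cplx_form x y = 0) -> x = 0.
Proof.
move=> x_orth; suff [x1 x2] : x.1 = 0 /\ x.2 = 0 by rewrite [x]surjective_pairing x1 x2.
split; apply: Omega_nondegP => v; have := x_orth (cplx_in v).
  by rewrite /cplx_form /= !linear0r subr0 => -[].
by rewrite /cplx_form /= !linear0r add0r => -[].
Qed.

Lemma cplx_form_isometry x y :
  cplx_form (cplx_lfun A x) (cplx_lfun A y) = cplx_form x y.
Proof. by rewrite /cplx_form !cplx_lfunE /= !A_isometry. Qed.

Lemma cplx_formDl x y z : cplx_form (x + y) z = cplx_form x z + cplx_form y z.
Proof. by have := cplx_form_linearl z 1 x y; rewrite !scale1r. Qed.

Lemma cplx_formDr x y z : cplx_form x (y + z) = cplx_form x y + cplx_form x z.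
Proof. by have := cplx_form_linearr x 1 y z; rewrite !scale1r. Qed.

(** For real mu the two summands coincide, which lets the real and the complex case
    share the duality argument. *)
Definition conj_eigenspace mu : {vspace cplx V} :=
  (gen_eigenspace (cplx_lfun A) mu + gen_eigenspace (cplx_lfun A) mu^*)%VS.

Let orthogonal_eigenspaces := gen_eigenspace_orthogonal
  cplx_form_linearl cplx_form_linearr cplx_form_nondeg cplx_form_isometry.

(** The two conditions on lam and mu give those on their conjugates. *)
Lemma Omega_orthogonal lam mu L L' u v : lam != 0 -> mu != 0 ->
    lam * mu != 1 -> lam * mu^* != 1 ->
    cplx_vspace L = conj_eigenspace lam -> cplx_vspace L' = conj_eigenspace mu ->
  u \in L -> v \in L' -> Omega u v = 0.
Proof.
move=> lam0 mu0 neq1 neq1' defL defL' /cplx_in_vspace + /cplx_in_vspace.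
rewrite defL defL' => /memv_addP[x xE [x' x'E ux]] /memv_addP[y yE [y' y'E vy]].
have neq2 : lam^* * mu^* != 1 by rewrite -rmorphM fmorph_eq1.
have neq2' : lam^* * mu != 1.
  by apply: contra neq1' => /eqP eq1; rewrite -[lam]conjCK -rmorphM eq1 rmorph1.
have lam0' : lam^* != 0 by rewrite conjC_eq0.
suff : cplx_form (cplx_in u) (cplx_in v) = 0.
  by rewrite /cplx_form /= !linear0r subr0 => -[].
rewrite ux vy !cplx_formDl !cplx_formDr.
rewrite (orthogonal_eigenspaces lam0 neq1 xE yE).
rewrite (orthogonal_eigenspaces lam0 neq1' xE y'E).
rewrite (orthogonal_eigenspaces lam0' neq2' x'E yE).
by rewrite (orthogonal_eigenspaces lam0' neq2 x'E y'E) !addr0.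
Qed.

(** If lam is not real, the components of u in the two eigenspaces can be treated
    separately: each is paired with one summand of the other space and orthogonal to
    the second. *)
Lemma Omega_pairing lam L L' u : lam != 0 ->
    cplx_vspace L = conj_eigenspace lam ->
    cplx_vspace L' = conj_eigenspace lam^-1 ->
  u \in L -> {in L', forall v, Omega u v = 0} -> u = 0.
Proof.
move=> lam0 defL defL' uL u_orth.
suff /(congr1 fst) : cplx_in u = 0 by [].
have lam0' : lam^* != 0 by rewrite conjC_eq0.
have u_orthC y : y \in cplx_vspace L' -> cplx_form (cplx_in u) y = 0.
  rewrite memv_cplx => /andP[y1 y2].
  by rewrite /cplx_form /= !linear0l !u_orth // subr0 addr0.
have pairing mu x : mu != 0 -> x \in gen_eigenspace (cplx_lfun A) mu ->
    {in gen_eigenspace (cplx_lfun A) mu^-1, forall y, cplx_form x y = 0} -> x = 0.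
  exact: gen_eigenspace_pairing cplx_form_linearl cplx_form_linearr
    cplx_form_nondeg cplx_form_isometry _ _.
move: uL => /cplx_in_vspace; rewrite defL /conj_eigenspace.
rewrite defL' /conj_eigenspace fmorphV in u_orthC.
have subl := subvP (addvSl (gen_eigenspace (cplx_lfun A) lam^-1)
  (gen_eigenspace (cplx_lfun A) (lam^*)^-1)).
have subr := subvP (addvSr (gen_eigenspace (cplx_lfun A) lam^-1)
  (gen_eigenspace (cplx_lfun A) (lam^*)^-1)).
have [<-|neq_lam] := eqVneq lam lam^*.
  rewrite addvv => uE; apply: pairing lam0 uE _ => y /subl; exact: u_orthC.
case/memv_addP=> x xE [x' x'E ux]; rewrite ux in u_orthC *.
have neq1 : lam * (lam^*)^-1 != 1.
  by apply: contra neq_lam => /eqP/divr1_eq/eqP.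
have neq1' : lam^* * lam^-1 != 1.
  by apply: contra neq_lam => /eqP/divr1_eq/eqP; rewrite eq_sym.
have -> : x = 0.
  apply: pairing lam0 xE _ => y yE; have := u_orthC y (subl _ yE).
  by rewrite cplx_formDl (orthogonal_eigenspaces lam0' neq1' x'E yE) addr0.
have -> : x' = 0; last by rewrite addr0.
apply: pairing lam0' x'E _ => y yE; have := u_orthC y (subr _ yE).
by rewrite cplx_formDl (orthogonal_eigenspaces lam0 neq1 xE yE) add0r.
Qed.

Lemma conj_eigenspace_stable mu L v :
  cplx_vspace L = conj_eigenspace mu -> v \in L -> A v \in L.
Proof.
move=> defL vL.
suff : cplx_lfun A (cplx_in v) \in cplx_vspace L.
  by rewrite memv_cplx cplx_lfunE => /andP[].
have := cplx_in_vspace vL; rewrite defL => /memv_addP[x xE [y yE ->]].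
by rewrite linearD memv_add ?gen_eigenspace_stable.
Qed.

Lemma conj_eigenspace_real mu : {L | cplx_vspace L = conj_eigenspace mu}.
Proof.
apply: cplx_descent => x /memv_addP[y yE [z zE ->]].
have cy := cplx_conj_gen_eigenspace yE; have := cplx_conj_gen_eigenspace zE.
rewrite conjCK => cz; rewrite cplx_conjD addrC; exact: memv_add cz cy.
Qed.

End ComplexifiedForm.

(** * Completing a basis of an isotropic subspace by its dual basis *)

Section SymplecticExtension.
Context {R : realType} {V : vectType R} (Omega : {skew_symmetric V}) (A : 'End(V)).
Implicit Types (L : {vspace V}) (u v : V).

Lemma Omega_skew u v : Omega u v = - Omega v u.
Proof. by rewrite hermC expr1 mulN1r. Qed.

Lemma Omega_suml n (c : 'I_n -> R) (u : 'I_n -> V) v :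
  Omega (\sum_i c i *: u i) v = \sum_i c i * Omega (u i) v.
Proof. by rewrite linear_sumlz; apply: eq_bigr => i _; rewrite linearZl_LR. Qed.

Lemma Omega_sumr n (c : 'I_n -> R) (u : 'I_n -> V) v :
  Omega v (\sum_i c i *: u i) = \sum_i c i * Omega v (u i).
Proof. by rewrite linear_sumr; apply: eq_bigr => i _; rewrite linearZr_LR. Qed.

Lemma Omega_subr u v w : Omega u (v - w) = Omega u v - Omega u w.
Proof. exact: linearBr. Qed.

Definition pairing_map n (e : n.-tuple V) v : 'rV[R]_n := \row_i Omega (tnth e i) v.

Fact pairing_map_is_linear n (e : n.-tuple V) : linear (pairing_map e).
Proof.
by move=> a u v; apply/rowP => i; rewrite !mxE linearDr linearZr_LR.
Qed.

HB.instance Definition _ n (e : n.-tuple V) :=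
  GRing.isLinear.Build R V 'rV[R]_n _ (pairing_map e) (pairing_map_is_linear e).

Definition separates L L' :=
  forall v, v \in L' -> {in L, forall u, Omega u v = 0} -> v = 0.

Lemma basis_orthogonal n (e : n.-tuple V) L v : basis_of L e ->
  (forall i, Omega (tnth e i) v = 0) -> {in L, forall u, Omega u v = 0}.
Proof.
move=> e_basis v_orth u /(coord_basis e_basis) ->; rewrite Omega_suml big1 // => i _.
by rewrite -tnth_nth v_orth mulr0.
Qed.

(** A vector of L' is determined by its products with a basis of L. *)
Lemma pairing_map_dim n (e : n.-tuple V) L L' : basis_of L e -> separates L L' ->
  \dim (linfun (pairing_map e) @: L')%VS = \dim L'.
Proof.
move=> e_basis sep; rewrite limg_dim_eq //; apply/eqP; rewrite -subv0.
apply/subvP => v; rewrite memv_cap memv_ker memv0 lfunE /= => /andP[vL' /eqP v0].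
apply/eqP/sep => //; apply: (basis_orthogonal e_basis) => i.
by have /rowP/(_ i) := v0; rewrite !mxE.
Qed.

Lemma separates_leq_dim L L' : separates L L' -> (\dim L' <= \dim L)%N.
Proof.
move=> /(pairing_map_dim (vbasisP L)) <-.
by rewrite (leq_trans (dimvS (subvf _))) // dimvf dim_matrix mul1r.
Qed.

(** Separation on both sides makes the dimensions equal, so the injective pairing map of
    L' is onto and hits the coordinate vectors. *)
Lemma dual_basis n (e : n.-tuple V) L L' : basis_of L e ->
    separates L L' -> separates L' L ->
  exists2 f : n.-tuple V, basis_of L' f &
    forall i j, Omega (tnth e i) (tnth f j) = (i == j)%:R.
Proof.
move=> e_basis sep sep'; have dimL := size_basis e_basis.
have dimL' : \dim L' = n.
  by apply/eqP; rewrite -dimL eqn_leq !separates_leq_dim.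
have img_full : (linfun (pairing_map e) @: L')%VS = fullv.
  apply/eqP; rewrite eqEdim subvf (pairing_map_dim e_basis sep) dimvf.
  by rewrite dim_matrix mul1r dimL' leqnn.
have lift j : exists v, (v \in L') && [forall i, Omega (tnth e i) v == (i == j)%:R].
  have : delta_mx 0 j \in (linfun (pairing_map e) @: L')%VS.
    by rewrite img_full memvf.
  case/memv_imgP => v vL'; rewrite lfunE /= => /rowP vE; exists v.
  rewrite vL'; apply/forallP => i; have := vE i.
  by rewrite !mxE eqxx eq_sym /= => ->.
have [f fP] : exists f : n.-tuple V, forall j,
    (tnth f j \in L') && [forall i, Omega (tnth e i) (tnth f j) == (i == j)%:R].
  exists [tuple xchoose (lift j) | j < n] => j.
  by rewrite tnth_mktuple; exact: (xchooseP (lift j)).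
have dual i j : Omega (tnth e i) (tnth f j) = (i == j)%:R.
  by have /andP[_ /forallP/(_ i)/eqP] := fP j.
exists f => //; rewrite basisEfree size_tuple dimL' leqnn andbT; apply/andP; split.
  apply/freeP => c sum0 i.
  have : Omega (tnth e i) 0 = 0 by rewrite linear0r.
  rewrite -sum0 Omega_sumr (bigD1 i) //=.
  rewrite big1 => [|j /negPf neq_ji].
    by rewrite addr0 -tnth_nth dual eqxx mulr1.
  by rewrite -tnth_nth dual eq_sym neq_ji mulr0.
by apply/span_subvP => _ /tnthP[j ->]; have /andP[] := fP j.
Qed.

Section Extension.
Hypothesis A_isometry : isometry Omega Omega A.
Hypothesis A_inj : injective A.

Lemma has_matrix_unit n (e : n.-tuple V) L M :
  basis_of L e -> has_matrix A e M -> M \in unitmx.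
Proof.
move=> e_basis eM; rewrite -unitmx_tr -row_free_unit; apply: inj_row_free => c cM.
apply/rowP => j; rewrite mxE; have /freeP free_e := basis_free e_basis.
apply: (free_e (fun j => c 0 j)); apply: A_inj; rewrite linear0 linear_sum.
under eq_bigr do rewrite linearZ /= -tnth_nth eM scaler_sumr.
rewrite exchange_big big1 //= => i _.
under eq_bigr do rewrite scalerA.
rewrite -scaler_suml; have /rowP/(_ i) := cM; rewrite !mxE => cMi.
suff -> : \sum_(j < n) c 0 j * M i j = 0 by rewrite scale0r.
by rewrite -[RHS]cMi; apply: eq_bigr => l _; rewrite mxE.
Qed.

Lemma has_matrix_cat m n (e : m.-tuple V) (f : n.-tuple V) M N :
  has_matrix A e M -> has_matrix A f N ->
  has_matrix A [tuple of e ++ f] (block_mx M 0 0 N).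
Proof.
move=> eM fN j; rewrite big_split_ord /=.
case: (split_ordP j) => {}j ->.
  rewrite tnth_lshift eM [X in _ = _ + X]big1 => [|i _].
    by rewrite addr0; apply: eq_bigr => i _; rewrite block_mxEul tnth_lshift.
  by rewrite block_mxEdl mxE scale0r.
rewrite tnth_rshift fN [X in _ = X + _]big1 => [|i _].
  by rewrite add0r; apply: eq_bigr => i _; rewrite block_mxEdr tnth_rshift.
by rewrite block_mxEur mxE scale0r.
Qed.

(** A f_j and the candidate combination of the f_i have the same products with all the
    A e_i, and the A e_i span L because M is invertible. *)
Lemma has_matrix_dual n (e f : n.-tuple V) L L' M : basis_of L e ->
    basis_of L' f -> separates L L' -> {in L', forall v, A v \in L'} ->
    (forall i j, Omega (tnth e i) (tnth f j) = (i == j)%:R) ->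
  has_matrix A e M -> has_matrix A f (invmx M)^T.
Proof.
move=> e_basis f_basis sep L'_stable dual eM j.
have M_unit := has_matrix_unit e_basis eM.
have fL' i : tnth f i \in L' by apply: (basis_mem f_basis); apply: mem_tnth.
apply/eqP; rewrite -subr_eq0; apply/eqP/sep.
  by rewrite memvB ?L'_stable // memv_suml // => i _; rewrite memvZ.
set w := _ - _; have w_orth i : Omega (A (tnth e i)) w = 0.
  rewrite /w Omega_subr A_isometry dual eM Omega_suml.
  under eq_bigr => l _.
    rewrite Omega_sumr (bigD1 l) //= big1 => [|m /negPf neq_ml].
      by rewrite dual eqxx mulr1 addr0 mxE mulrC; over.
    by rewrite dual eq_sym neq_ml mulr0.
  have /matrixP/(_ j i) := mulVmx M_unit; rewrite !mxE eq_sym => ->.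
  by rewrite subrr.
apply: (basis_orthogonal e_basis) => i.
(* M is invertible, so e can be recovered from its image under A. *)
have -> : tnth e i = \sum_l invmx M l i *: A (tnth e l).
  under eq_bigr do rewrite eM scaler_sumr.
  rewrite exchange_big /= (bigD1 i) //= [X in _ + X]big1 => [|m /negPf neq_mi].
    under eq_bigr do rewrite scalerA mulrC.
    rewrite -scaler_suml; have /matrixP/(_ i i) := mulmxV M_unit.
    by rewrite !mxE eqxx => ->; rewrite scale1r addr0.
  under eq_bigr do rewrite scalerA mulrC.
  rewrite -scaler_suml; have /matrixP/(_ m i) := mulmxV M_unit.
  by rewrite !mxE neq_mi => ->; rewrite scale0r.
by rewrite Omega_suml big1 // => l _; rewrite w_orth mulr0.
Qed.

Lemma symplectic_extension n (e : n.-tuple V) L L' M : basis_of L e ->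
    separates L L' -> separates L' L ->
    {in L &, forall u v, Omega u v = 0} -> {in L' &, forall u v, Omega u v = 0} ->
    {in L', forall v, A v \in L'} -> has_matrix A e M ->
  exists e' : (n + n).-tuple V,
    is_symplectic_basis Omega (L + L')%VS e' /\ has_matrix A e' (inv_tr_block M).
Proof.
move=> e_basis sep sep' isoL isoL' L'_stable eM.
have [f f_basis dual] := dual_basis e_basis sep sep'.
have eL i : tnth e i \in L by apply: (basis_mem e_basis); apply: mem_tnth.
have fL' i : tnth f i \in L' by apply: (basis_mem f_basis); apply: mem_tnth.
exists [tuple of e ++ f]; split; last first.
  by apply: has_matrix_cat => //; exact: has_matrix_dual e_basis f_basis sep L'_stable dual eM.
split.
  apply: cat_basis => //; apply/directv_addP/eqP; rewrite -subv0; apply/subvP => v.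
  rewrite memv_cap memv0 => /andP[vL vL']; apply/eqP/sep => // u uL; exact: isoL.
move=> i j; rewrite /symplectic_mx.
case: (split_ordP i) => {}i ->; case: (split_ordP j) => {}j ->;
  rewrite ?tnth_lshift ?tnth_rshift.
- by rewrite block_mxEul mxE isoL.
- by rewrite block_mxEur mxE dual.
- by rewrite block_mxEdl !mxE Omega_skew dual eq_sym.
- by rewrite block_mxEdr mxE isoL'.
Qed.

End Extension.

(** * Block diagonal matrices *)

Fixpoint diag_blocks (d : nat -> nat) (N : forall q, 'M[R]_(d q)) (s : seq nat) :
    'M[R]_(sumn (map d s)) :=
  if s is q :: s' then block_mx (N q) 0 0 (diag_blocks N s') else 0.

Lemma sympl_sums_inv_tr_block d (N : forall q, 'M[R]_(d q)) s :
  diag_blocks N s \in unitmx ->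
  sympl_sums (fun q => inv_tr_block (N q)) s = inv_tr_block (diag_blocks N s).
Proof.
elim: s => [_|q s IHs] /=; first by apply/matrixP => -[].
move=> N_unit; have := N_unit; rewrite unitmxE det_ublock unitrM => /andP[_ s_unit].
rewrite IHs ?unitmxE // /sympl_sum /inv_tr_block.
rewrite !(block_mxKul, block_mxKur, block_mxKdl, block_mxKdr) !block_mx0.
by rewrite invmx_block_diag // tr_block_mx !trmx0.
Qed.

(** Only the span of the concatenated basis is tracked: freeness is recovered at the end
    by counting dimensions. *)
Lemma has_matrix_diag_blocks d (N : forall q, 'M[R]_(d q)) (T : eqType)
    (s : seq (T * nat)) (X : T * nat -> {vspace V}) :
    {in s, forall c, exists2 e : (d c.2).-tuple V, has_matrix A e (N c.2) &
       (X c <= <<e>>)%VS} ->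
  exists2 e : (sumn (map d (map snd s))).-tuple V,
    has_matrix A e (diag_blocks N (map snd s)) & (\sum_(c <- s) X c <= <<e>>)%VS.
Proof.
elim: s => [_|c s IHs sE].
  by exists [tuple]; [case | rewrite big_nil sub0v].
have [|e eN sX] := IHs; first by move=> b bs; apply: sE; rewrite inE bs orbT.
have [f fN cX] := sE c (mem_head _ _).
exists [tuple of f ++ e]; first exact: has_matrix_cat.
by rewrite big_cons span_cat addvS.
Qed.

End SymplecticExtension.

(** * Jordan blocks from chains *)

Section JordanBlocks.

Lemma chain_step (K : fieldType) (U : vectType K) (f : 'End(U)) lam x q
    (z := fun i : 'I_q.+1 => lfun_pow (f - lam *: \1%VF) (q - i) x) (j : 'I_q.+1) :
  lfun_pow (f - lam *: \1%VF) q.+1 x = 0 ->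
  f (z j) = lam *: z j + \sum_(i < q.+1 | i.+1 == j) z i.
Proof.
move=> x0; apply/eqP; rewrite addrC -subr_eq -sub_scaleE /z -lfun_powS; apply/eqP.
case: j => [[|j] lt_j]; first by rewrite subn0 x0 big_pred0.
rewrite (big_pred1 (Ordinal (ltnW lt_j))) => [|i]; last by rewrite /= -[RHS]val_eqE.
by congr (lfun_pow _ _ x); rewrite -subSn // subSS.
Qed.

Context {R : realType} {V : vectType R} (A : 'End(V)).

Lemma has_matrix_Jordan l x q :
    lfun_pow (A - l *: \1%VF) q.+1 x = 0 ->
  exists2 e : q.+1.-tuple V, has_matrix A e (Jordan l q.+1) &
    (<<chain (A - l *: \1%VF) (x, q)>> <= <<e>>)%VS.
Proof.
move=> x0; pose z (i : 'I_q.+1) := lfun_pow (A - l *: \1%VF) (q - i) x.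
exists [tuple z i | i < q.+1].
  move=> j; rewrite tnth_mktuple (chain_step _ x0).
  under [RHS]eq_bigr do rewrite tnth_mktuple mxE scalerDl.
  rewrite big_split /= [X in _ = X + _](bigD1 j) //= eqxx mulr1n.
  rewrite [X in _ + X + _]big1 => [|i /negPf neq_ij].
    rewrite addr0; congr (_ + _); rewrite [LHS]big_mkcond; apply: eq_bigr => i _.
    by case: eqP => _; rewrite ?scale1r ?scale0r.
  by rewrite neq_ij mulr0n scale0r.
apply/sub_span => _ /mem_chainP[i lt_i ->].
by apply/tnthP; exists (Ordinal (lt_i : (i < q.+1)%N)); rewrite tnth_mktuple.
Qed.

Lemma sum_blocks n (p : 'I_n -> nat) (F : forall i, 'I_(p i) -> V) :
  \sum_(k < \sum_(i < n) p i) F (tagnat.sig1 k) (tagnat.sig2 k) =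
  \sum_(i < n) \sum_(b < p i) F i b.
Proof. by rewrite sig_big_dep /= [RHS](reindex _ tagnat.sig_bij_on). Qed.

(** The parts are Re z and - Im z: the sign makes multiplication by r e^(i phi) act by
    the rotation block itself rather than by its transpose. *)
Definition real_part (b : 'I_2) (z : cplx V) : V := if b == ord0 then z.1 else - z.2.

Lemma real_partD b : {morph real_part b : y z / y + z}.
Proof. by move=> y z; rewrite /real_part; case: ifP => //= _; rewrite opprD. Qed.

Lemma real_part_lfun b z : A (real_part b z) = real_part b (cplx_lfun A z).
Proof. by rewrite /real_part cplx_lfunE; case: ifP => //= _; rewrite linearN. Qed.

Lemma real_part_rot r phi b z :
  real_part b (((r * cos phi) +i* (r * sin phi))%C *: z) =
  \sum_(a < 2) Defs.rot r phi a b *: real_part a z.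
Proof.
rewrite !big_ord_recl big_ord0 addr0 !mxE /real_part /=.
case: b => [[|[|]] lt_b] //=; rewrite ?opprD scalerN ?scaleNr.
  by [].
by rewrite addrC.
Qed.

(** Taking real parts of [chain_step]: the scalar lam becomes the diagonal rotation block
    and the step to the previous vector becomes an identity block. *)
Lemma has_matrix_Jordan_real r phi x q
    (lam := ((r * cos phi) +i* (r * sin phi))%C) (g := cplx_lfun A - lam *: \1%VF) :
    lfun_pow g q.+1 x = 0 ->
  exists2 e : (\sum_(i < q.+1) 2)%N.-tuple V, has_matrix A e (Jordan_real r phi q.+1) &
    (<<[seq z.1 | z : cplx V <- chain g (x, q)]>> +
     <<[seq z.2 | z : cplx V <- chain g (x, q)]>> <= <<e>>)%VS.
Proof.
move=> x0; pose z (i : 'I_q.+1) : cplx V := lfun_pow g (q - i) x.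
pose e := [tuple real_part (tagnat.sig2 k) (z (tagnat.sig1 k)) | k < \sum_(i < q.+1) 2].
have e_mem i b : real_part b (z i) \in e.
  apply/tnthP; exists (tagnat.Rank i b); rewrite tnth_mktuple tagnat.Rank1K.
  by congr real_part; apply: val_inj; rewrite tagnat.Rank2K.
exists e.
  move=> k; rewrite tnth_mktuple; set b := tagnat.sig2 k; set j := tagnat.sig1 k.
  transitivity (\sum_(i < q.+1) \sum_(a < 2)
      (Defs.rot r phi *+ (i == j) + 1%:M *+ (i.+1 == j)) a b *: real_part a (z i)); last first.
    rewrite -sum_blocks; apply: eq_bigr => i _.
    by rewrite tnth_mktuple [in RHS]mxE.
  rewrite real_part_lfun (chain_step _ x0) real_partD real_part_rot -/(z j).
  under [RHS]eq_bigr do under eq_bigr do rewrite mxE !mulmxnE scalerDl.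
  under [RHS]eq_bigr do rewrite big_split /=.
  rewrite big_split /= [X in _ = X + _](bigD1 j) //= [X in _ = _ + X + _]big1; last first.
    by move=> i /negPf neq_ij; rewrite big1 // => a _; rewrite neq_ij mulr0n scale0r.
  rewrite addr0; congr (_ + _).
    by apply: eq_bigr => a _; rewrite eqxx mulr1n.
  have real_part0 : real_part b 0 = 0 by rewrite /real_part; case: ifP; rewrite ?oppr0.
  rewrite (big_morph (real_part b) (real_partD b) real_part0) big_mkcond.
  apply: eq_bigr => i _; case: eqP => _.
    rewrite (bigD1 b) //= big1 => [|a /negPf neq_ab]; last first.
      by rewrite mulr1n mxE neq_ab scale0r.
    by rewrite mulr1n mxE eqxx scale1r addr0.
  by rewrite big1 // => a _; rewrite mulr0n scale0r.
rewrite subv_add; apply/andP; split; apply/span_subvP => _ /mapP[w wz ->];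
  have [i lt_i ->] := mem_chainP _ _ _ wz.
  by have := e_mem (Ordinal (lt_i : (i < q.+1)%N)) ord0; apply: memv_span.
by have := e_mem (Ordinal (lt_i : (i < q.+1)%N)) ord_max; rewrite -memvN => /memv_span.
Qed.

End JordanBlocks.

(** * Symplectic bases of the space attached to an eigenvalue *)

Section BracketSpaceBases.
Context {R : realType} {V : vectType R} (Omega : {skew_symmetric V}) (A : 'End(V)).
Hypothesis Omega_nondeg : nondegenerate Omega.
Hypothesis A_isometry : isometry Omega Omega A.

Lemma cplx_vspaceD (L L' : {vspace V}) :
  cplx_vspace (L + L')%VS = (cplx_vspace L + cplx_vspace L')%VS.
Proof.
apply/vspaceP => x; rewrite memv_cplx; apply/andP/memv_addP.
  case=> /memv_addP[u1 uL1 [v1 vL1 x1]] /memv_addP[u2 uL2 [v2 vL2 x2]].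
  exists (u1, u2); first by rewrite memv_cplx uL1 uL2.
  exists (v1, v2); first by rewrite memv_cplx vL1 vL2.
  by rewrite [x]surjective_pairing x1 x2.
case=> y; rewrite memv_cplx => /andP[y1 y2] [z]; rewrite memv_cplx => /andP[z1 z2] ->.
by rewrite !memv_add.
Qed.

Lemma bracket_spaceD lam (L L' W : {vspace V}) : is_bracket_space A lam W ->
    cplx_vspace L = conj_eigenspace A lam ->
    cplx_vspace L' = conj_eigenspace A lam^-1 -> W = (L + L')%VS.
Proof.
move=> bW defL defL'; have [W0 [_ uniqW]] := is_bracket_space_ex A lam.
rewrite -(uniqW _ bW); apply: uniqW; rewrite /is_bracket_space cplx_vspaceD defL defL'.
rewrite /bracket big_undup; last exact: addvv.
have addvACA (E1 E2 E3 E4 : {vspace cplx V}) :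
    (E1 + E2 + (E3 + E4) = E1 + (E3 + (E2 + (E4 + 0))))%VS.
  by rewrite addv0 -addvA; congr (_ + _)%VS; rewrite addvA [X in (X + _)%VS]addvC addvA.
rewrite !big_cons big_nil /conj_eigenspace (_ : lam^-1^* = lam^*^-1); last first.
  exact: fmorphV.
exact: addvACA.
Qed.

Lemma eigenvalue_neq0 lam : passmx.leigenvalue (cplx_lfun A) lam -> lam != 0.
Proof.
apply: contraTneq => ->; rewrite negbK /passmx.leigenspace scale0r subr0.
exact: isometry_ker0 (cplx_form_linearl Omega) (cplx_form_nondeg Omega_nondeg)
  (cplx_form_isometry A_isometry).
Qed.

Lemma isometry_inj : injective A.
Proof.
move=> u v Auv; apply/eqP; rewrite -subr_eq0; apply/eqP.
apply: (Omega_nondegP Omega_nondeg) => w.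
by rewrite -A_isometry linearB /= Auv subrr linear0l.
Qed.

(** Only a block diagonal matrix of A on L has to be found: the other half of the
    symplectic basis comes from the duality with the subspace attached to 1/lam. *)
Lemma bracket_space_basis (lam : R[i]) (L W : {vspace V}) d (N : forall q, 'M[R]_(d q)) s
    (e : (sumn (map d s)).-tuple V) :
    lam != 0 -> `|lam| != 1 -> is_bracket_space A lam W ->
    cplx_vspace L = conj_eigenspace A lam -> basis_of L e ->
    has_matrix A e (diag_blocks N s) ->
  exists e', is_symplectic_basis Omega W e' /\
    has_matrix A e' (sympl_sums (fun q => inv_tr_block (N q)) s).
Proof.
move=> lam0 norm_lam bW defL e_basis eN.
have [L' defL'] := conj_eigenspace_real A lam^-1.
have neq1 (mu : R[i]) : `|mu| != 1 -> mu * mu != 1 /\ mu * mu^* != 1.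
  move=> mu_norm; have mu2 : `|mu| ^+ 2 != 1 by rewrite sqrp_eq1.
  split; last by rewrite -normCK.
  by apply: contra mu2 => /eqP; rewrite -normrX expr2 => ->; rewrite normr1.
have norm_lamV : `|lam^-1| != 1 by rewrite normfV invr_eq1.
have lamV0 : lam^-1 != 0 by rewrite invr_eq0.
rewrite sympl_sums_inv_tr_block; last exact: has_matrix_unit isometry_inj _ _ _ _ e_basis eN.
rewrite (bracket_spaceD bW defL defL').
have sep : separates Omega L L'.
  move=> v vL' v_orth; have defL2 : cplx_vspace L = conj_eigenspace A lam^-1^-1.
    by rewrite invrK.
  apply: (Omega_pairing Omega_nondeg A_isometry lamV0 defL' defL2 vL') => u uL.
  by rewrite Omega_skew v_orth ?oppr0.
have sep' : separates Omega L' L.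
  move=> u uL u_orth.
  apply: (Omega_pairing Omega_nondeg A_isometry lam0 defL defL' uL) => v vL'.
  by rewrite Omega_skew u_orth ?oppr0.
have [ne1 ne1'] := neq1 _ norm_lam; have [nV1 nV1'] := neq1 _ norm_lamV.
apply: symplectic_extension isometry_inj _ _ _ _ _ e_basis sep sep' _ _ _ eN => //.
- move=> u v uL vL.
  exact: (Omega_orthogonal Omega_nondeg A_isometry lam0 lam0 ne1 ne1' defL defL uL vL).
- move=> u v uL vL.
  exact: (Omega_orthogonal Omega_nondeg A_isometry lamV0 lamV0 nV1 nV1' defL' defL' uL vL).
- by move=> v; apply: conj_eigenspace_stable defL'.
Qed.

End BracketSpaceBases.

(** * Jordan chains of a generalized eigenspace *)

Lemma gen_eigenspace_chain_basis (K : fieldType) (U : vectType K) (f : 'End(U)) mu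
    (E := gen_eigenspace f mu) (g := f - mu *: \1%VF) p :
    passmx.leigenspace f mu != 0%VS -> (E <= lker (lfun_pow g p.+1))%VS ->
    (forall q, (E <= lker (lfun_pow g q.+1))%VS -> (p <= q)%N) ->
  exists s, [/\ basis_of E (chains g s), {in s, forall c, lfun_pow g c.2.+1 c.1 = 0},
    size s = \dim (passmx.leigenspace f mu), sorted geq (map snd s)
    & head 0%N (map snd s) = p].
Proof.
move=> ker_neq0 Ep pmin.
have gE : (g @: E <= E)%VS.
  by apply/subvP => _ /memv_imgP[x xE ->]; apply: gen_eigenspace_sub_stable.
have [s [sB sK s_sorted]] := nilpotent_chain_basis gE Ep.
have kerE : (E :&: lker g)%VS = lker g by apply/capv_idPr/lker_sub_gen_eigenspace.
exists s; split=> //.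
- move=> c cs; have := basis_mem sK (map_f (fun b => lfun_pow g b.2 b.1) cs).
  by rewrite memv_cap memv_ker -lfun_powS => /andP[_ /eqP].
- by rewrite /passmx.leigenspace -kerE (size_basis (X := in_tuple _) sK) size_map.
- apply: nilpotency_index sB sK s_sorted _ Ep pmin.
  apply: contraNneq ker_neq0 => E0.
  by rewrite -subv0 -E0; apply: lker_sub_gen_eigenspace.
Qed.

Lemma span_chains (K : fieldType) (U : vectType K) (g : 'End(U)) s :
  <<chains g s>>%VS = (\sum_(c <- s) <<chain g c>>)%VS.
Proof.
elim: s => [|c s IHs]; first by rewrite big_nil span_nil.
by rewrite big_cons -IHs -span_cat.
Qed.

Local Open Scope complex_scope.

Theorem theorem23 (R : realType) (V : vectType R)
    (Omega : {skew_symmetric V}) (hOmega : is_psymplectic Omega)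
    (A : 'End(V)) (hA : isometry Omega Omega A)
    (lam : R[i]) (hlam : passmx.leigenvalue (cplx_lfun A) lam) (hS1 : `|lam| != 1)
    (k : nat) (hk : k = \dim (passmx.leigenspace (cplx_lfun A) lam))
    (p : nat)
    (hp : (gen_eigenspace (cplx_lfun A) lam
             <= lker (lfun_pow (cplx_lfun A - lam *: \1%VF) p.+1))%VS)
    (hpmin : forall q : nat,
        (gen_eigenspace (cplx_lfun A) lam
           <= lker (lfun_pow (cplx_lfun A - lam *: \1%VF) q.+1))%VS ->
        (p <= q)%N)
    (W : {vspace V}) (hW : is_bracket_space A lam W) :
  (forall l : R, lam = l%:C -> l != 1 -> l != -1 ->
     exists ps : k.-tuple nat,
       [/\ head 0%N ps = p, sorted geq ps &
           let M := sympl_sums (fun q => inv_tr_block (Jordan l q.+1)) ps in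
           exists e, is_symplectic_basis Omega W e /\ has_matrix A e M])
  /\
  (forall r phi : R, 0 < r -> lam = (r * cos phi) +i* (r * sin phi) ->
     lam \isn't Num.real ->
     exists ps : k.-tuple nat,
       [/\ head 0%N ps = p, sorted geq ps &
           let M :=
             sympl_sums (fun q => inv_tr_block (Jordan_real r phi q.+1)) ps in
           exists e, is_symplectic_basis Omega W e /\ has_matrix A e M]).
Proof.
have [Omega_nondeg _ _] := hOmega.
have lam0 := eigenvalue_neq0 Omega_nondeg hA hlam.
split=> [l def_lam _ _|r phi _ def_lam lam_nonreal].
  (* For real lam, chains must be taken over the reals: a Jordan basis of the complex
     eigenspace need not consist of real vectors. *)
  have dim_ker : \dim (passmx.leigenspace (cplx_lfun A) lam) =
      \dim (passmx.leigenspace A l).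
    by rewrite def_lam leigenspace_real dim_cplx_vspace.
  have [|||s [sB s0 size_s s_sorted s_head]] :=
      @gen_eigenspace_chain_basis _ _ A l p.
  - by rewrite -dimv_eq0 -dim_ker dimv_eq0.
  - by rewrite -sub_lker_pow_real -gen_eigenspace_real -def_lam.
  - by move=> q; rewrite -sub_lker_pow_real -gen_eigenspace_real -def_lam; apply: hpmin.
  have size_ps : size (map snd s) == k by rewrite size_map size_s hk dim_ker.
  exists (Tuple size_ps); split=> //=.
  have [c cs|e eN sub_e] := @has_matrix_diag_blocks R V A succn
      (fun q => Jordan l q.+1) _ s (fun c => <<chain (A - l *: \1%VF) c>>%VS).
    by case: c cs => x q /s0; apply: has_matrix_Jordan.
  have defL : cplx_vspace (gen_eigenspace A l) = conj_eigenspace A lam.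
    rewrite -gen_eigenspace_real /conj_eigenspace def_lam.
    have -> : Num.conj l%:C = l%:C by apply/eqP; rewrite eq_complex /= oppr0 !eqxx.
    by rewrite addvv.
  apply: (bracket_space_basis Omega_nondeg hA lam0 hS1 hW defL _ eN).
  rewrite basisEdim -[X in (X <= _)%VS](span_basis sB) span_chains sub_e.
  by rewrite (size_basis (X := in_tuple _) sB) size_tuple size_chains -map_comp leqnn.
subst lam; set lam := (_ +i* _) in hlam lam_nonreal *.
have [|s [sB s0 size_s s_sorted s_head]] := gen_eigenspace_chain_basis _ hp hpmin.
  exact: hlam.
have size_ps : size (map snd s) == k by rewrite size_map size_s hk.
exists (Tuple size_ps); split=> //=.
pose g := cplx_lfun A - lam *: \1%VF.
have [c cs|e eN sub_e] := @has_matrix_diag_blocks R V A _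
    (fun q => Jordan_real r phi q.+1) _ s
    (fun c => <<[seq z.1 | z : cplx V <- chain g c]>> +
              <<[seq z.2 | z : cplx V <- chain g c]>>)%VS.
  by case: c cs => x q /s0; apply: has_matrix_Jordan_real.
have [L defL] := conj_eigenspace_real A lam.
apply: (bracket_space_basis Omega_nondeg hA lam0 hS1 hW defL _ eN).
rewrite basisEdim; apply/andP; split.
  apply: sub_real_parts defL sB _ => z /mem_chainsP[c cs zc].
  have sub_c := subv_trans _ sub_e; rewrite (big_rem c cs) /= in sub_c.
  have [sub1 sub2] := (subv_trans (addvSl _ _) (sub_c _ (addvSl _ _)),
                       subv_trans (addvSr _ _) (sub_c _ (addvSl _ _))).
  split.
    by apply: (subvP sub1); apply: memv_span; apply: (map_f (fun w : cplx V => w.1) zc).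
  by apply: (subvP sub2); apply: memv_span; apply: (map_f (fun w : cplx V => w.2) zc).
(* There are twice as many real vectors as chain vectors, that is 2 dim E_lam. *)
apply: leq_trans (double_dim_gen_eigenspace _ defL).
  rewrite (size_basis (X := in_tuple _) sB) size_tuple size_chains.
  elim: (s) => //= c s' IHs; rewrite mulnDr leq_add //.
  by rewrite sum_nat_const card_ord mulnC.
by rewrite eq_sym -CrealE.
Qed.
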